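(* Let $X$ be a finite biquandle and $R$ a commutative ring with identity. If $\beta$ and $\beta'$ are $C$-equivalent $X$-brackets over $R$, then they define the same invariant: $\Phi_X^{\beta}(L)=\Phi_X^{\beta'}(L)$ for every oriented link $L$.
   Context: \textbf{Biquandle.} A biquandle is a set $X$ with two binary operations $\underline{\triangleright},\overline{\triangleright}:X\times X\to X$ such that for all $x,y,z\in X$: (i) $x\,\underline{\triangleright}\,x=x\,\overline{\triangleright}\,x$; (ii) the maps $\alpha_y,\beta_y:X\to X$ and $S:X\times X\to X\times X$ given by $\alpha_y(x)=x\,\overline{\triangleright}\,y$, $\beta_y(x)=x\,\underline{\triangleright}\,y$, $S(x,y)=(y\,\overline{\triangleright}\,x,\;x\,\underline{\triangleright}\,y)$ are invertible; (iii) the exchange laws hold: \[(x\,\underline{\triangleright}\,y)\,\underline{\triangleright}\,(z\,\underline{\triangleright}\,y)=(x\,\underline{\triangleright}\,z)\,\underline{\triangleright}\,(y\,\overline{\triangleright}\,z),\] \[(x\,\underline{\triangleright}\,y)\,\overline{\triangleright}\,(z\,\underline{\triangleright}\,y)=(x\,\overline{\triangleright}\,z)\,\underline{\triangleright}\,(y\,\overline{\triangleright}\,z),\] \[(x\,\overline{\triangleright}\,y)\,\overline{\triangleright}\,(z\,\overline{\triangleright}\,y)=(x\,\overline{\triangleright}\,z)\,\overline{\triangleright}\,(y\,\underline{\triangleright}\,z).\] \textbf{Biquandle bracket.} Let $X$ be a finite biquandle and $R$ a commutative ring with identity, with group of units $R^\times$. A biquandle bracket on $X$ with values in $R$ (also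 called an $X$-bracket over $R$) is a pair of maps $A,B:X\times X\to R^{\times}$, written $A_{x,y}=A(x,y)$ and $B_{x,y}=B(x,y)$, together with distinguished elements $\delta\in R$ and $w\in R^\times$ such that: (i) for all $x\in X$, $\delta A_{x,x}+B_{x,x}=w$ and $\delta A_{x,x}^{-1}+B_{x,x}^{-1}=w^{-1}$; (ii) for all $x,y\in X$, $\delta=-A_{x,y}B_{x,y}^{-1}-A_{x,y}^{-1}B_{x,y}$; (iii) for all $x,y,z\in X$, writing $a=x\,\underline{\triangleright}\,y$, $b=z\,\overline{\triangleright}\,y$, $c=y\,\overline{\triangleright}\,x$, $d=z\,\overline{\triangleright}\,x$, $e=x\,\underline{\triangleright}\,z$, $f=y\,\underline{\triangleright}\,z$, \[A_{x,y}A_{y,z}A_{a,b}=A_{x,z}A_{c,d}A_{e,f},\] \[A_{x,y}B_{y,z}B_{a,b}=B_{x,z}B_{c,d}A_{e,f},\] \[B_{x,y}A_{y,z}B_{a,b}=B_{x,z}A_{c,d}B_{e,f},\] \[A_{x,y}A_{y,z}B_{a,b}=A_{x,z}B_{c,d}A_{e,f}+A_{x,z}A_{c,d}B_{e,f}+\delta A_{x,z}B_{c,d}B_{e,f}+B_{x,z}B_{c,d}B_{e,f},\] \[B_{x,y}A_{y,z}A_{a,b}+A_{x,y}B_{y,z}A_{a,b}+\delta B_{x,y}B_{y,z}A_{a,b}+B_{x,y}B_{y,z}B_{a,b}=B_{x,z}A_{c,d}A_{e,f}.\] \textbf{$C$-equivalence.} Two $X$-brackets $\beta$ (with maps $A,B$)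 and $\beta'$ (with maps $A',B'$) over $R$ are $C$-equivalent if there is a map $C:X\to R^{\times}$ such that for all $x,y\in X$, \[A'_{x,y}=A_{x,y}\,C(x)C(y)^{-1}C(x\,\underline{\triangleright}\,y)^{-1}C(y\,\overline{\triangleright}\,x)\quad\text{and}\quad B'_{x,y}=B_{x,y}\,C(x)C(y)^{-1}C(x\,\underline{\triangleright}\,y)^{-1}C(y\,\overline{\triangleright}\,x).\] \textbf{Colorings.} A biquandle coloring (or $X$-labeling) of an oriented link diagram $D$ assigns an element of $X$ to each semiarc (edge of the underlying 4-valent graph of $D$) so that at each crossing, drawn with both strands oriented downward, if the left-hand under-semiarc is colored $x$ and the left-hand over-semiarc is colored $y$, then the right-hand under-semiarc is colored $x\,\underline{\triangleright}\,y$ and the right-hand over-semiarc is colored $y\,\overline{\triangleright}\,x$. (So at a positive crossing the incoming under-semiarc is $x$, the outgoing under-semiarc is $x\,\underline{\triangleright}\,y$, the incoming over-semiarc is $y\,\overline{\triangleright}\,x$ and the outgoing over-semiarc is $y$; at a negative crossing the incoming under-semiarc is $x\,\underline{\triangleright}\,y$, the outgoing under-semiarc is $x$, the incoming over-semiarc is $y$ and the outgoing over-semiarc is $y\,\overline{\triangleright}\,x$.) The pair $(x,y)$ is the pair of colors attached to the crossing. Colorings of a diagram of $L$ correspond to biquandle homomorphisms $f\in\mathrm{Hom}(\mathcal{B}(L),X)$ from the fundamental biquandle of $L$. \textbf{The invariant.} Given an $X$-bracket $\beta$ and an $X$-coloring $f$ of an oriented link diagram $D$ with $p$ positive and $n$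 negative crossings, a state is a choice, at every crossing, of the oriented smoothing (the one consistent with the orientation) or the unoriented smoothing (the other one). At a positive crossing with colors $(x,y)$ the oriented smoothing has coefficient $A_{x,y}$ and the unoriented one $B_{x,y}$; at a negative crossing the coefficients are $A_{x,y}^{-1}$ and $B_{x,y}^{-1}$ respectively. Define \[\beta(f)=w^{n-p}\sum_{\text{states}}\Big(\prod_{\text{crossings}}\text{smoothing coefficient}\Big)\delta^{k},\] where $k$ is the number of circles in the state. This is unchanged by $X$-colored Reidemeister moves. For an oriented link $L$, the biquandle bracket multiset invariant is the multiset $\Phi_X^{\beta,M}(L)=\{\beta(f)\mid f\in\mathrm{Hom}(\mathcal{B}(L),X)\}$, and the biquandle bracket polynomial is $\Phi_X^{\beta}(L)=\sum_{f}u^{\beta(f)}$, a formal sum in which $u$ is a formal variable with exponents in $R$; it encodes the same information as the multiset. *)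

(* Defs.v *)
From HB Require Import structures.
From mathcomp Require Import all_boot all_order all_algebra all_fingroup.
From mathcomp.multinomials Require Import freeg.

Set Implicit Arguments.
Unset Strict Implicit.
Unset Printing Implicit Defensive.

Import GRing.Theory.
Local Open Scope ring_scope.

Reserved Notation "x |>_ y" (at level 40, left associativity).
Reserved Notation "x |>^ y" (at level 40, left associativity).

Record is_biquandle (T : Type) (ut ot : T -> T -> T) : Prop := IsBiquandle {
  biq_diag : forall x, ut x x = ot x x;
  biq_over_bij : forall y, bijective (fun x => ot x y);
  biq_under_bij : forall y, bijective (fun x => ut x y);
  biq_switch_bij : bijective (fun p : T * T => (ot p.2 p.1, ut p.1 p.2));
  biq_exch_uu : forall x y z, ut (ut x y) (ut z y) = ut (ut x z) (ot y z);
  biq_exch_uo : forall x y z, ot (ut x y) (ut z y) = ut (ot x z) (ot y z);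
  biq_exch_oo : forall x y z, ot (ot x y) (ot z y) = ot (ot x z) (ut y z)
}.

Record finBiquandle := FinBiquandle {
  biq_sort :> finType;
  biq_under : biq_sort -> biq_sort -> biq_sort;
  biq_over : biq_sort -> biq_sort -> biq_sort;
  biqP : is_biquandle biq_under biq_over
}.

Notation "x |>_ y" := (biq_under x y) : ring_scope.
Notation "x |>^ y" := (biq_over x y) : ring_scope.

(* The library attaches units to unitRingType only, which excludes the zero
   ring; here R is an arbitrary commutative ring, and an element of R^* is
   stored together with its (unique) inverse. *)
Record unit_of (R : comPzRingType) := UnitOf {
  uval : R;
  uinv : R;
  uvalK : uval * uinv = 1
}.

Section Bracket.
Variables (X : finBiquandle) (R : comPzRingType).
Variables (A B : X -> X -> unit_of R) (delta : R) (w : unit_of R).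

Local Notation a x y := (uval (A x y)).
Local Notation b x y := (uval (B x y)).
Local Notation a' x y := (uinv (A x y)).
Local Notation b' x y := (uinv (B x y)).

Record is_bracket : Prop := IsBracket {
  brk_w : forall x, delta * a x x + b x x = uval w;
  brk_winv : forall x, delta * a' x x + b' x x = uinv w;
  brk_delta : forall x y,
    delta = - (a x y * b' x y) - a' x y * b x y;
  brk_AAA : forall x y z : X,
    a x y * a y z * a (x |>_ y) (z |>^ y) =
    a x z * a (y |>^ x) (z |>^ x) * a (x |>_ z) (y |>_ z);
  brk_ABB : forall x y z : X,
    a x y * b y z * b (x |>_ y) (z |>^ y) =
    b x z * b (y |>^ x) (z |>^ x) * a (x |>_ z) (y |>_ z);
  brk_BAB : forall x y z : X,
    b x y * a y z * b (x |>_ y) (z |>^ y) =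
    b x z * a (y |>^ x) (z |>^ x) * b (x |>_ z) (y |>_ z);
  brk_AAB : forall x y z : X,
    a x y * a y z * b (x |>_ y) (z |>^ y) =
    a x z * b (y |>^ x) (z |>^ x) * a (x |>_ z) (y |>_ z)
    + a x z * a (y |>^ x) (z |>^ x) * b (x |>_ z) (y |>_ z)
    + delta * a x z * b (y |>^ x) (z |>^ x) * b (x |>_ z) (y |>_ z)
    + b x z * b (y |>^ x) (z |>^ x) * b (x |>_ z) (y |>_ z);
  brk_BAA : forall x y z : X,
    b x y * a y z * a (x |>_ y) (z |>^ y)
    + a x y * b y z * a (x |>_ y) (z |>^ y)
    + delta * b x y * b y z * a (x |>_ y) (z |>^ y)
    + b x y * b y z * b (x |>_ y) (z |>^ y) =
    b x z * a (y |>^ x) (z |>^ x) * a (x |>_ z) (y |>_ z)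
}.

End Bracket.

Record bracket (X : finBiquandle) (R : comPzRingType) := Bracket {
  brA : X -> X -> unit_of R;
  brB : X -> X -> unit_of R;
  brdelta : R;
  brw : unit_of R;
  bracketP : is_bracket brA brB brdelta brw
}.

Definition C_equivalent (X : finBiquandle) (R : comPzRingType)
    (b b' : bracket X R) : Prop :=
  exists C : X -> unit_of R, forall x y : X,
    uval (brA b' x y) =
      uval (brA b x y) * uval (C x) * uinv (C y) * uinv (C (x |>_ y))
      * uval (C (y |>^ x))
    /\ uval (brB b' x y) =
      uval (brB b x y) * uval (C x) * uinv (C y) * uinv (C (x |>_ y))
      * uval (C (y |>^ x)).

(* A diagram is given combinatorially (a signed oriented Gauss/PD code).
   In a crossing c,
     - (c, false) is the under-strand and (c, true) the over-strand;
     - each strand o has an incoming end (c, o, false) and an outgoing end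
       (c, o, true).
   [pd_next] sends a strand (c, o) to the strand (c', o') reached by following
   the semiarc that leaves c along o.  [pd_loops] is the number of components
   without crossings.  These data determine the diagram on the sphere up to
   the relative placement of the connected components of the diagram, on which
   neither the link nor the colorings and state circles depend. *)
Record pd_code := PdCode {
  crossing : finType;
  positive : pred crossing;
  pd_next : {perm crossing * bool};
  pd_loops : nat
}.

Section PdCode.
Variable D : pd_code.

Definition strand : finType := (crossing D * bool)%type.

Definition strand_end : finType := (strand * bool)%type.

Definition other_end (e : strand_end) : strand_end :=
  if e.2 then (pd_next D e.1, false) else ((pd_next D)^-1%g e.1, true).

(* The next end counterclockwise around the crossing.  With both strands drawn
   downward, the counterclockwise order starting from the top left is
     positive: under-in, over-out, under-out, over-in;
     negative: over-in, under-out, over-out, under-in. *)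
Definition rotate (e : strand_end) : strand_end :=
  let: (c, o, out) := e in
  ((c, ~~ o), out (+) (o (+) positive c)).

Definition num_faces : nat := fcard (rotate \o other_end) predT.

Definition num_components : nat :=
  n_comp [rel e e' : strand_end | (e' == other_end e) || (e'.1.1 == e.1.1)]
         predT.

(* Euler's formula V + F = E + 2 C for the underlying 4-valent graph, i.e. all
   its connected components have genus 0.  There is one edge per strand. *)
Definition planar : bool :=
  (#|crossing D| + num_faces == #|strand| + 2 * num_components)%N.

End PdCode.

Record link_diagram := LinkDiagram {
  diagram_code :> pd_code;
  diagram_planar : planar diagram_code
}.

Section Colorings.
Variables (X : finBiquandle) (D : link_diagram).

(* A semiarc with endpoints is named by the strand along which it leaves its
   initial crossing. *)
Definition semiarc : finType := (strand D + 'I_(pd_loops D))%type.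

Definition labeling : finType := {ffun semiarc -> X}.

Definition end_color (f : labeling) (e : strand_end D) : X :=
  f (inl (if e.2 then e.1 else (pd_next D)^-1%g e.1)).

(* With both strands drawn downward, the left-hand (resp. right-hand) ends are
   under-in and over-out (resp. under-out and over-in) at a positive crossing,
   and under-out and over-in (resp. under-in and over-out) at a negative one. *)
Definition left_under (f : labeling) (c : crossing D) : X :=
  end_color f (c, false, ~~ positive c).
Definition left_over (f : labeling) (c : crossing D) : X :=
  end_color f (c, true, positive c).
Definition right_under (f : labeling) (c : crossing D) : X :=
  end_color f (c, false, positive c).
Definition right_over (f : labeling) (c : crossing D) : X :=
  end_color f (c, true, ~~ positive c).

Definition is_coloring (f : labeling) : bool :=
  [forall c : crossing D,
     (right_under f c == left_under f c |>_ left_over f c)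
     && (right_over f c == left_over f c |>^ left_under f c)].

End Colorings.

Section Invariant.
Variables (X : finBiquandle) (R : comPzRingType).
Variables (b : bracket X R) (D : link_diagram).

(* A state is given by the set of crossings that get the oriented smoothing. *)
Definition state : finType := {set crossing D}.

(* The end joined to e inside the crossing: the oriented smoothing joins the
   incoming end of each strand to the outgoing end of the other one, the
   unoriented smoothing joins the two incoming ends and the two outgoing
   ends. *)
Definition smoothed (s : state) (e : strand_end D) : strand_end D :=
  let: (c, o, out) := e in
  (c, ~~ o, if c \in s then ~~ out else out).

Definition num_circles (s : state) : nat :=
  (n_comp [rel e e' : strand_end D | (e' == other_end e)
                                     || (e' == smoothed s e)] predT
   + pd_loops D)%N.

Definition smoothing_coef (f : labeling X D) (s : state) (c : crossing D) : R :=
  let x := left_under f c in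
  let y := left_over f c in
  let a := if c \in s then brA b x y else brB b x y in
  if positive c then uval a else uinv a.

Definition num_positive : nat := #|[pred c : crossing D | positive c]|.
Definition num_negative : nat := #|[pred c : crossing D | ~~ positive c]|.

(* w ^ (n - p) is written w ^ n * (w^-1) ^ p. *)
Definition bracket_value (f : labeling X D) : R :=
  uval (brw b) ^+ num_negative * uinv (brw b) ^+ num_positive
  * \sum_(s : state)
      (\prod_(c : crossing D) smoothing_coef f s c)
      * brdelta b ^+ num_circles s.

(* The formal sum of the u ^ (bracket_value f), in the free abelian group on
   the symbols u ^ r with r in R; <<r>> is the basis element u ^ r. *)
Definition bracket_polynomial : {freeg R / int} :=
  \sum_(f : labeling X D | is_coloring f) << bracket_value f >>.

End Invariant.

(* Main.v *)
Require Import Defs.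
From HB Require Import structures.
From mathcomp Require Import all_boot all_order all_algebra all_fingroup.
From mathcomp.multinomials Require Import freeg.
From mathcomp Require Import ring.

(** Passing from [b] to [b'] multiplies both smoothing coefficients of a
    crossing by the same factor, which a coloring turns into the product of the
    values of [C] on the two incoming semiarcs divided by the product of its
    values on the two outgoing ones, whatever the sign of the crossing.  Every
    semiarc leaves one crossing and enters one, so the factors of a whole state
    cancel.  The constants [delta] and [w] are determined by the bracket axioms
    at a point of [X], where the gauge factor drops out; if [X] is empty, only
    the empty diagram has a coloring, and its value is 1. *)

Set Implicit Arguments.
Unset Strict Implicit.
Unset Printing Implicit Defensive.

Import GRing.Theory.
Local Open Scope ring_scope.

Lemma uinv_unique (R : comPzRingType) (u : unit_of R) (r : R) :
  uval u * r = 1 -> uinv u = r.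
Proof.
by move=> ur; rewrite -[LHS]mulr1 -ur mulrA [uinv u * _]mulrC uvalK mul1r.
Qed.

(** Negative crossings carry inverse coefficients, while [C_equivalent] constrains only the [uval]
    parts. *)
Lemma uinv_gauge (R : comPzRingType) (u v p q r s : unit_of R) :
  uval v = uval u * uval p * uinv q * uinv r * uval s ->
  uinv v = uinv u * uinv p * uval q * uval r * uinv s.
Proof.
move=> vE; apply: uinv_unique; rewrite vE.
transitivity ((uval u * uinv u) * (uval p * uinv p) * (uval q * uinv q)
              * (uval r * uinv r) * (uval s * uinv s)); first by ring.
by rewrite !uvalK !mulr1.
Qed.

Section GaugeInvariance.
Variables (X : finBiquandle) (R : comPzRingType) (b b' : bracket X R).
Variable C : X -> unit_of R.
Hypothesis gaugeC : forall x y : X,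
  uval (brA b' x y) =
    uval (brA b x y) * uval (C x) * uinv (C y) * uinv (C (x |>_ y))
    * uval (C (y |>^ x))
  /\ uval (brB b' x y) =
    uval (brB b x y) * uval (C x) * uinv (C y) * uinv (C (x |>_ y))
    * uval (C (y |>^ x)).

(** By [biq_diag], [x |>_ x] and [x |>^ x] coincide, so the four values of [C] cancel in pairs. *)
Lemma gauge_diag (x : X) :
  [/\ uval (brA b' x x) = uval (brA b x x),
      uval (brB b' x x) = uval (brB b x x),
      uinv (brA b' x x) = uinv (brA b x x)
    & uinv (brB b' x x) = uinv (brB b x x)].
Proof.
have factor1 (r : R) :
    r * uval (C x) * uinv (C x) * uinv (C (x |>_ x)) * uval (C (x |>^ x)) = r.
  rewrite -(biq_diag (biqP X)) -mulrA [uinv (C (x |>_ x)) * _]mulrC uvalK mulr1.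
  by rewrite -mulrA uvalK mulr1.
have [AE BE] := gaugeC x x; rewrite !factor1 in AE BE.
by split=> //; apply: uinv_unique; rewrite ?AE ?BE uvalK.
Qed.

Lemma gauge_delta (x : X) : brdelta b' = brdelta b.
Proof.
have [AE BE AVE BVE] := gauge_diag x.
by rewrite (brk_delta (bracketP b') x x) (brk_delta (bracketP b) x x) AE BE AVE
  BVE.
Qed.

Lemma gauge_w (x : X) :
  uval (brw b') = uval (brw b) /\ uinv (brw b') = uinv (brw b).
Proof.
have [AE BE AVE BVE] := gauge_diag x.
rewrite -(brk_w (bracketP b') x) -(brk_w (bracketP b) x).
rewrite -(brk_winv (bracketP b') x) -(brk_winv (bracketP b) x).
by rewrite AE BE AVE BVE (gauge_delta x).
Qed.

Section Coloring.
Variables (D : link_diagram) (f : labeling X D).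
Hypothesis colf : is_coloring f.

Definition flow (o : strand D) : R :=
  uval (C (end_color f (o, false))) * uinv (C (end_color f (o, true))).

Lemma prod_flow : \prod_(o : strand D) flow o = 1.
Proof.
(* Only the incoming factors are reindexed: the end entering [pd_next D o] lies on the semiarc
   leaving [o]. *)
rewrite big_split /= (reindex_inj (@perm_inj _ (pd_next D))) /= -big_split /=.
apply: big1 => o _; rewrite /end_color /= permK; exact: uvalK.
Qed.

Lemma smoothing_coef_gauge (s : state D) (c : crossing D) :
  smoothing_coef b' f s c =
  smoothing_coef b f s c * (flow (c, true) * flow (c, false)).
Proof.
have /andP[/eqP ruE /eqP roE] := forallP colf c.
have [AE BE] := gaugeC (left_under f c) (left_over f c).
rewrite -ruE -roE in AE BE.
have AVE := uinv_gauge AE; have BVE := uinv_gauge BE.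
rewrite /smoothing_coef /flow; move: AE BE AVE BVE.
rewrite /left_under /left_over /right_under /right_over.
(* A sign change swaps incoming and outgoing ends and also inverts the coefficient, so the same flow
   results. *)
by case: (positive c) => /= AE BE AVE BVE; case: (c \in s);
  rewrite ?AE ?BE ?AVE ?BVE; ring.
Qed.

Lemma prod_smoothing_coef_gauge (s : state D) :
  \prod_(c : crossing D) smoothing_coef b' f s c =
  \prod_(c : crossing D) smoothing_coef b f s c.
Proof.
under eq_bigr => c _ do rewrite smoothing_coef_gauge.
rewrite big_split /= -[RHS]mulr1; congr (_ * _); apply: etrans prod_flow.
under eq_bigr => c _ do rewrite -(big_bool _ (fun o => flow (c, o))).
by rewrite pair_bigA; apply: eq_bigr => -[].
Qed.

Lemma bracket_value_gauge : bracket_value b' f = bracket_value b f.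
Proof.
rewrite /bracket_value.
under eq_bigr => s _ do rewrite prod_smoothing_coef_gauge.
case: (pickP (mem X)) => [x _ | X0].
  by have [-> ->] := gauge_w x; rewrite (gauge_delta x).
(* Over an empty [X] the axioms are vacuous and the two [delta] and [w] may differ. They occur only
   to the power 0, since [f] would color any semiarc or crossingless loop. *)
have noX (P : Prop) (x : X) : P by have := X0 x.
have no_crossing (c : crossing D) : False by exact: noX (left_under f c).
have no_circle (s : state D) : num_circles s = 0%N.
  rewrite /num_circles; case: (posnP (pd_loops D)) => [->|lt0].
    by rewrite addn0; apply: eq_card0 => -[[c]]; case: (no_crossing c).
  exact: noX (f (inr (Ordinal lt0))).
have -> : num_positive D = 0%N by apply: eq_card0 => c; case: (no_crossing c).
have -> : num_negative D = 0%N by apply: eq_card0 => c; case: (no_crossing c).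
by rewrite !expr0; congr (_ * _); apply: eq_bigr => s _; rewrite no_circle !expr0.
Qed.

End Coloring.
End GaugeInvariance.

Theorem corollary3 (X : finBiquandle) (R : comPzRingType)
    (b b' : bracket X R) :
  C_equivalent b b' ->
  forall L : link_diagram, bracket_polynomial b L = bracket_polynomial b' L.
Proof.
move=> [C gaugeC] L; rewrite /bracket_polynomial.
by apply: eq_bigr => f colf; rewrite (bracket_value_gauge gaugeC colf).
Qed.
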